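(* Let $R:\mathcal{L}(\mathcal{H}_n)\to\mathcal{L}(\mathcal{H}_n)$ be the reduction map $R(X)={\rm Tr}(X)I-X$. Then $\mathcal{M}_{\{R\}}=\mathcal{SP}_2\circ t$ (and equivalently, $\mathcal{M}_{\{R\circ t\}}=\mathcal{SP}_2$), where $t$ is the transpose map on $\mathcal{L}(\mathcal{H}_n)$.
   Context: $\mathcal{H}_n$ is an $n$-dimensional complex Hilbert space with a fixed orthonormal basis, $\mathcal{L}(\mathcal{H}_n)$ is the space of linear operators on it, $I$ is the identity operator, and the transpose is taken with respect to this basis. A linear map $\Phi:\mathcal{L}(\mathcal{H}_n)\to\mathcal{L}(\mathcal{H}_n)$ is positive if $\Phi(X)\ge 0$ whenever $X\ge 0$ (positive semidefinite), and completely positive if $id_k\otimes\Phi$ is positive for every $k\in\mathbb{N}$, where $id_k$ is the identity map on $\mathcal{L}(\mathcal{H}_k)$. $\mathcal{P}_1$ and $\mathcal{CP}$ denote the sets of positive and completely positive maps on $\mathcal{L}(\mathcal{H}_n)$. For $A\in\mathcal{L}(\mathcal{H}_n)$, ${\rm Ad}_A(X)=AXA^*$. $\mathcal{SP}_2$ is the set of $2$-superpositive maps: those of the form $\sum_i{\rm Ad}_{A_i}$ (finite sum) with ${\rm rank}(A_i)\le 2$ for all $i$; $\mathcal{SP}_2\circ t:=\{\Phi\circ t:\Phi\in\mathcal{SP}_2\}$. For $\mathcal{Q}\subset\mathcal{P}_1$, the convex mapping cone generated by $\mathcal{Q}$ is $\mathcal{M}_{\mathcal{Q}}:=\{\sum_i\Phi_i\circ\Omega_i\circ\Psi_i:\Omega_i\in\mathcal{Q},\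 \Phi_i,\Psi_i\in\mathcal{CP}\ \forall i\}$ (finite sums).
   Formalization: The dimension n is assumed different from 1: for n = 1 the reduction map R is zero, so the cone generated by R is {0}, while the set of 2-superpositive maps composed with t contains the nonzero identity map, and the claim fails. *)

(* Defs.v *)
From HB Require Import structures.
From mathcomp Require Import all_boot all_order all_algebra.
From mathcomp Require Import sesquilinear spectral.
From mathcomp Require Import classical_sets reals.
From mathcomp Require Import complex mxtens.

Set Implicit Arguments.
Unset Strict Implicit.
Unset Printing Implicit Defensive.

Import Order.TTheory GRing.Theory Num.Theory.

Local Open Scope ring_scope.
Local Open Scope classical_set_scope.
Local Open Scope sesquilinear_scope.

(* Operators on an n-dimensional Hilbert space over C with a fixed orthonormal
   basis are the matrices 'M[C]_n, acting on column vectors; the adjoint of A is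
   the conjugate transpose A ^t*, and 'End('M[C]_n) is the type of linear maps
   on operators, with (f \o g)%VF their composition. *)
Section MappingCones.
Variable C : numClosedFieldType.

(* In a numClosedFieldType, 0 <= z entails that z is real; over all vectors
   this forces X to be Hermitian. *)
Definition psdmx n (X : 'M[C]_n) : Prop :=
  forall v : 'cV[C]_n, 0 <= (v ^t* *m X *m v) 0 0.

Definition positive_map n (Phi : 'End('M[C]_n)) : Prop :=
  forall X : 'M[C]_n, psdmx X -> psdmx (Phi X).

(* H_k (x) H_n is identified with C^(k * n) through mxtens_index, as in the
   Kronecker product *t; Phi (x) Psi is given by its values on the matrix units
   E_ij (x) E_pq, see tensmapE. *)
Definition tensmap_fun k n (Phi : 'End('M[C]_k)) (Psi : 'End('M[C]_n))
    (X : 'M[C]_(k * n)) : 'M[C]_(k * n) :=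
  \sum_(i < k) \sum_(j < k) \sum_(p < n) \sum_(q < n)
    X (mxtens_index (i, p)) (mxtens_index (j, q)) *:
      (Phi (delta_mx i j) *t Psi (delta_mx p q)).

Fact tensmap_is_linear k n (Phi : 'End('M[C]_k)) (Psi : 'End('M[C]_n)) :
  linear (tensmap_fun Phi Psi).
Proof.
move=> a X Y; rewrite /tensmap_fun scaler_sumr -big_split; apply: eq_bigr => i _.
rewrite scaler_sumr -big_split; apply: eq_bigr => j _.
rewrite scaler_sumr -big_split; apply: eq_bigr => p _.
rewrite scaler_sumr -big_split; apply: eq_bigr => q _ /=.
by rewrite !mxE scalerDl scalerA.
Qed.

HB.instance Definition _ k n (Phi : 'End('M[C]_k)) (Psi : 'End('M[C]_n)) :=
  GRing.isLinear.Build C 'M[C]_(k * n) 'M[C]_(k * n) *:%R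
    (tensmap_fun Phi Psi) (tensmap_is_linear Phi Psi).

Definition tensmap k n (Phi : 'End('M[C]_k)) (Psi : 'End('M[C]_n)) :
  'End('M[C]_(k * n)) := linfun (tensmap_fun Phi Psi).

Lemma tensmapE k n (Phi : 'End('M[C]_k)) (Psi : 'End('M[C]_n)) A B :
  tensmap Phi Psi (A *t B) = Phi A *t Psi B.
Proof.
have tsuml I (r : seq I) (F : I -> 'M[C]_k) (M : 'M[C]_n) :
    (\sum_(i <- r) F i) *t M = \sum_(i <- r) (F i *t M).
  apply/matrixP => s t; rewrite !(mxE, summxE) mulr_suml.
  by apply: eq_bigr => i _; rewrite mxE.
have tsumr I (r : seq I) (F : I -> 'M[C]_n) (M : 'M[C]_k) :
    M *t (\sum_(i <- r) F i) = \sum_(i <- r) (M *t F i).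
  apply/matrixP => s t; rewrite !(mxE, summxE) mulr_sumr.
  by apply: eq_bigr => i _; rewrite mxE.
rewrite lfunE /= /tensmap_fun [in RHS](matrix_sum_delta A).
rewrite [in RHS](matrix_sum_delta B) !linear_sum tsuml.
apply: eq_bigr => i _; rewrite linear_sum tsuml; apply: eq_bigr => j _.
rewrite tsumr; apply: eq_bigr => p _; rewrite linear_sum tsumr.
apply: eq_bigr => q _; rewrite !linearZ tensmxE.
by apply/matrixP => s t; rewrite !mxE; apply: mulrACA.
Qed.

Definition completely_positive n : set 'End('M[C]_n) :=
  [set Phi | forall k : nat, positive_map (tensmap (\1%VF : 'End('M[C]_k)) Phi)].

Definition Ad_fun n (A X : 'M[C]_n) : 'M[C]_n := A *m X *m A ^t*.

Fact Ad_is_linear n (A : 'M[C]_n) : linear (Ad_fun A).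
Proof.
by move=> a X Y; rewrite /Ad_fun mulmxDr mulmxDl -scalemxAr -scalemxAl.
Qed.

HB.instance Definition _ n (A : 'M[C]_n) :=
  GRing.isLinear.Build C 'M[C]_n 'M[C]_n *:%R (Ad_fun A) (Ad_is_linear A).

Definition Ad n (A : 'M[C]_n) : 'End('M[C]_n) := linfun (Ad_fun A).

Lemma AdE n (A X : 'M[C]_n) : Ad A X = A *m X *m A ^t*.
Proof. by rewrite lfunE. Qed.

Definition superpositive (r n : nat) : set 'End('M[C]_n) :=
  [set Phi | exists m (A : 'I_m -> 'M[C]_n),
     (forall i, (\rank (A i) <= r)%N) /\ Phi = \sum_(i < m) Ad (A i)].

Definition transpose_map n : 'End('M[C]_n) := linfun trmx.

Lemma transpose_mapE n (X : 'M[C]_n) : transpose_map n X = X^T.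
Proof. by rewrite lfunE. Qed.

Definition reduction_fun n (X : 'M[C]_n) : 'M[C]_n := \tr X *: 1%:M - X.

Fact reduction_is_linear n : linear (@reduction_fun n).
Proof.
move=> a X Y; rewrite /reduction_fun mxtraceD mxtraceZ scalerDl -scalerA.
by rewrite scalerBr opprD addrACA.
Qed.

HB.instance Definition _ n :=
  GRing.isLinear.Build C 'M[C]_n 'M[C]_n *:%R
    (@reduction_fun n) (@reduction_is_linear n).

Definition reduction_map n : 'End('M[C]_n) := linfun (@reduction_fun n).

Lemma reduction_mapE n (X : 'M[C]_n) : reduction_map n X = \tr X *: 1%:M - X.
Proof. by rewrite lfunE. Qed.

Definition mapping_cone n (Q : set 'End('M[C]_n)) : set 'End('M[C]_n) :=
  [set Theta | exists m (Phi Omega Psi : 'I_m -> 'End('M[C]_n)),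
     (forall i, [/\ Q (Omega i), completely_positive (Phi i)
                  & completely_positive (Psi i)]) /\
     Theta = \sum_(i < m) (Phi i \o (Omega i \o Psi i))%VF].

End MappingCones.

Arguments completely_positive : clear implicits.
Arguments superpositive : clear implicits.
Arguments transpose_map : clear implicits.
Arguments reduction_map : clear implicits.

(* Main.v *)
(* By Choi's theorem the completely positive maps are the sums of maps [Ad A],
   and R \o t is the half-sum over i, j of Ad (E_ij - E_ji), hence
   2-superpositive; multiplying Kraus operators on either side does not raise
   their rank, so the cone generated by R \o t lies in SP_2. Conversely,
   compressing R \o t to the span of e_i and e_j gives Ad (E_ij - E_ji), and for
   i != j every A of rank at most 2 is of the form P (E_ij - E_ji) Q. The cone of
   R is that of R \o t precomposed with t, as t \o Psi \o t is completely positive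
   when Psi is. *)
Require Import Defs.
From mathcomp Require Import all_boot all_order all_algebra.
From mathcomp Require Import sesquilinear spectral mxtens ring.
From mathcomp Require Import classical_sets reals complex.

Import Order.TTheory GRing.Theory Num.Theory.

Local Open Scope ring_scope.
Local Open Scope classical_set_scope.
Local Open Scope sesquilinear_scope.

(** * Adjoints and positive semidefinite matrices *)

Section Adjoint.
Set Implicit Arguments.
Unset Strict Implicit.
Variable C : numClosedFieldType.

Lemma adjmxM m n p (A : 'M[C]_(m, n)) (B : 'M[C]_(n, p)) :
  (A *m B) ^t* = B ^t* *m A ^t*.
Proof. by rewrite trmx_mul map_mxM. Qed.

Lemma adjmxD m n (A B : 'M[C]_(m, n)) : (A + B) ^t* = A ^t* + B ^t*.
Proof. by rewrite linearD map_mxD. Qed.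

Lemma adjmxB m n (A B : 'M[C]_(m, n)) : (A - B) ^t* = A ^t* - B ^t*.
Proof. by rewrite linearB map_mxB. Qed.

Lemma adjmxZ m n (a : C) (A : 'M[C]_(m, n)) : (a *: A) ^t* = a^* *: A ^t*.
Proof. by rewrite linearZ map_mxZ. Qed.

Lemma adjmx_delta m n i j : (delta_mx i j : 'M[C]_(m, n)) ^t* = delta_mx j i.
Proof. by rewrite trmx_delta map_delta_mx. Qed.

Lemma mul_delta_mx_delta m n p q (X : 'M[C]_(n, p)) (i : 'I_m) j k (l : 'I_q) :
  delta_mx i j *m X *m delta_mx k l = X j k *: delta_mx i l.
Proof.
apply/matrixP => s t; rewrite mxE (bigD1 k) //= big1 ?addr0; last first.
  by move=> u uk; rewrite [delta_mx k l _ _]mxE (negbTE uk) mulr0.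
rewrite mxE (bigD1 j) //= big1 ?addr0; last first.
  by move=> u uj; rewrite [delta_mx i j _ _]mxE (negbTE uj) andbF mul0r.
rewrite !mxE !eqxx andbT /= mulrAC -natrM mulnb.
by rewrite mulrC.
Qed.

(** Polarization: the vectors e_k kill the diagonal, e_i + e_j gives Y_ij = - Y_ji, and e_i + 'i e_j
    then gives 2 'i Y_ji = 0. *)
Lemma form0_eq0 n (Y : 'M[C]_n) :
  (forall v : 'cV[C]_n, (v ^t* *m Y *m v) 0 0 = 0) -> Y = 0.
Proof.
move=> Y0; apply/matrixP => i j; rewrite mxE.
have formE (a b : C) (v := a *: delta_mx i 0 + b *: delta_mx j 0 : 'cV[C]_n) :
    (v ^t* *m Y *m v) 0 0 = a^* * a * Y i i + a^* * b * Y i j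
      + (b^* * a * Y j i + b^* * b * Y j j).
  rewrite /v adjmxD !adjmxZ !adjmx_delta !mulmxDl !mulmxDr.
  rewrite -!scalemxAl -!scalemxAr !scalerA !mul_delta_mx_delta !scalerA.
  by rewrite !mxE !mulr1.
have diag0 k : Y k k = 0.
  have := Y0 (delta_mx k 0).
  by rewrite adjmx_delta mul_delta_mx_delta !mxE !eqxx mulr1.
have := Y0 (1 *: delta_mx i 0 + 1 *: delta_mx j 0).
rewrite formE conjC1 !diag0 !mulr0 !mul1r add0r addr0 => /eqP.
rewrite addr_eq0 => /eqP Yij.
have := Y0 (1 *: delta_mx i 0 + 'i *: delta_mx j 0).
rewrite formE conjC1 !diag0 !mulr0 !mul1r mulr1 add0r addr0 Yij conjCi.
rewrite mulrN mulNr -opprD => /eqP; rewrite oppr_eq0 -mulr2n mulrn_eq0 /=.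
by rewrite mulf_eq0 (negbTE (neq0Ci _)) /= => /eqP ->; rewrite oppr0.
Qed.

(** The quadratic form of X takes real values, so that of [X ^t* - X] vanishes and X is Hermitian.
    Normality is what gives access to the spectral theorem. *)
Lemma psdmx_normal n (X : 'M[C]_n) : psdmx X -> X \is normalmx.
Proof.
move=> Xpsd; suff XE : X ^t* = X by apply/normalmxP; rewrite XE.
apply/eqP; rewrite -subr_eq0; apply/eqP; apply: form0_eq0 => v.
have -> : v ^t* *m (X ^t* - X) *m v
    = (v ^t* *m X *m v) ^t* - v ^t* *m X *m v.
  by rewrite mulmxBr mulmxBl !adjmxM trmxCK mulmxA.
move: (Xpsd v); move: (v ^t* *m X *m v) => z /ger0_real/CrealP zC.
by rewrite !mxE zC subrr.
Qed.

Lemma psdmx_factor n (X : 'M[C]_n) :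
  psdmx X -> exists B : 'M[C]_n, X = B *m B ^t*.
Proof.
move=> Xpsd; have /orthomx_spectralP := psdmx_normal Xpsd.
have Pu := spectral_unitarymx X; set P := spectralmx X in Pu *.
set d := spectral_diag X; rewrite (invmx_unitary Pu) => XE.
have dge0 i : 0 <= d 0 i.
  (* The adjoint of row i of P is an eigenvector, and the form takes the value [d 0 i] there. *)
  have := Xpsd ((delta_mx 0 i *m P) ^t*).
  rewrite trmxCK {1}XE adjmxM adjmx_delta !mulmxA.
  rewrite -[_ *m P *m P ^t*]mulmxA (unitarymxP Pu) mulmx1.
  rewrite -[_ *m P *m P ^t*]mulmxA (unitarymxP Pu) mulmx1.
  by rewrite mul_delta_mx_delta !mxE !eqxx mulr1n mulr1.
(* From X = P^* diag(d) P, the factor is B = P^* diag(sqrt d). *)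
pose s := \row_i sqrtC (d 0 i).
exists (P ^t* *m diag_mx s); rewrite adjmxM trmxCK XE !mulmxA; congr (_ *m _).
rewrite -mulmxA tr_diag_mx map_diag_mx mulmx_diag.
congr (_ *m diag_mx _); apply/rowP => i; rewrite !mxE.
by rewrite -normCK ger0_norm ?sqrtC_ge0 // sqrtCK.
Qed.

Lemma psdmx_gram m n (B : 'M[C]_(m, n)) : psdmx (B *m B ^t*).
Proof.
move=> v; set u := v ^t* *m B.
have -> : v ^t* *m (B *m B ^t*) *m v = u *m u ^t*.
  by rewrite /u adjmxM trmxCK !mulmxA.
rewrite mxE; apply: sumr_ge0 => i _.
by rewrite !mxE -normCK exprn_ge0.
Qed.

Lemma psdmx_sum n I (r : seq I) (F : I -> 'M[C]_n) :
  (forall i, psdmx (F i)) -> psdmx (\sum_(i <- r) F i).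
Proof.
move=> Fpsd v; rewrite mulmx_sumr mulmx_suml summxE.
by apply: sumr_ge0 => i _; apply: Fpsd.
Qed.

Lemma psdmx_conj m n (A : 'M[C]_(m, n)) X :
  psdmx X -> psdmx (A *m X *m A ^t*).
Proof.
move=> /psdmx_factor[B ->].
rewrite -!mulmxA -adjmxM mulmxA; exact: psdmx_gram.
Qed.

End Adjoint.

(** * Sums and compositions of superpositive maps *)

Section Superpositive.
Set Implicit Arguments.
Unset Strict Implicit.
Variable C : numClosedFieldType.
Implicit Types r s n : nat.

Lemma comp_lfun_suml (U V W : vectType C) I (t : seq I) (F : I -> 'Hom(V, W))
    (g : 'Hom(U, V)) :
  ((\sum_(i <- t) F i) \o g = \sum_(i <- t) (F i \o g))%VF.
Proof.
apply/lfunP => u; rewrite comp_lfunE !sum_lfunE.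
by apply: eq_bigr => i _; rewrite comp_lfunE.
Qed.

Lemma comp_lfun_sumr (U V W : vectType C) I (t : seq I) (f : 'Hom(V, W))
    (G : I -> 'Hom(U, V)) :
  (f \o (\sum_(i <- t) G i) = \sum_(i <- t) (f \o G i))%VF.
Proof.
apply/lfunP => u; rewrite comp_lfunE !sum_lfunE linear_sum.
by apply: eq_bigr => i _; rewrite comp_lfunE.
Qed.

Lemma Ad_comp n (A B : 'M[C]_n) : (Ad A \o Ad B)%VF = Ad (A *m B).
Proof. by apply/lfunP => X; rewrite comp_lfunE !AdE adjmxM !mulmxA. Qed.

Lemma superpositive_Ad r n (A : 'M[C]_n) :
  (\rank A <= r)%N -> superpositive C r n (Ad A).
Proof. by move=> rA; exists 1%N, (fun=> A); rewrite big_ord1. Qed.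

Lemma superpositiveD r n (Phi Psi : 'End('M[C]_n)) :
  superpositive C r n Phi -> superpositive C r n Psi ->
  superpositive C r n (Phi + Psi).
Proof.
move=> [m1 [A1 [rA1 ->]]] [m2 [A2 [rA2 ->]]].
exists (m1 + m2)%N, (fun i =>
  match split i with inl j => A1 j | inr j => A2 j end).
split=> [i|]; first by case: (split i).
rewrite big_split_ord /=; congr (_ + _); apply: eq_bigr => i _.
  by case: split_ordP => j /eqP; rewrite eq_shift // => /eqP ->.
by case: split_ordP => j /eqP; rewrite eq_shift // => /eqP ->.
Qed.

Lemma superpositive_sum r n I (t : seq I) (F : I -> 'End('M[C]_n)) :
  (forall i, superpositive C r n (F i)) ->
  superpositive C r n (\sum_(i <- t) F i).
Proof.
move=> SF; apply: (big_ind (superpositive C r n)) => //.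
- by exists 0%N, (fun=> 0); split=> [[]|] //; rewrite big_ord0.
- exact: superpositiveD.
Qed.

Lemma superpositive_le r s n :
  (r <= s)%N -> superpositive C r n `<=` superpositive C s n.
Proof.
move=> rs _ [m [A [rA ->]]]; exists m, A; split=> // i.
exact: leq_trans rs.
Qed.

(** The products A_i B_j are Kraus operators of the composition, and the rank of a product is
    bounded by that of each factor. *)
Lemma superpositive_comp r s n (Phi Psi : 'End('M[C]_n)) :
  superpositive C r n Phi -> superpositive C s n Psi ->
  superpositive C (minn r s) n (Phi \o Psi)%VF.
Proof.
move=> [m1 [A [rA ->]]] [m2 [B [rB ->]]].
rewrite comp_lfun_suml; apply: superpositive_sum => i.
rewrite comp_lfun_sumr; apply: superpositive_sum => j.
rewrite Ad_comp; apply: superpositive_Ad; rewrite leq_min.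
by rewrite (leq_trans (mxrankM_maxl _ _)) ?(leq_trans (mxrankM_maxr _ _)).
Qed.

(** * Tensor extensions, Choi's theorem and conjugation by the transpose *)

Lemma tensmx_sum_delta k n (X : 'M[C]_(k * n)) :
  X = \sum_(i < k) \sum_(j < k) \sum_(p < n) \sum_(q < n)
    X (mxtens_index (i, p)) (mxtens_index (j, q)) *:
      (delta_mx i j *t delta_mx p q).
Proof.
apply/matrixP => s t; case: (mxtens_indexP s) => i p.
case: (mxtens_indexP t) => j q.
rewrite summxE (bigD1 i) //= [X in _ + X]big1 => [|i' i'i]; last first.
  rewrite !summxE big1 // => j' _; rewrite !summxE big1 // => p' _.
  rewrite !summxE big1 // => q' _.
  by rewrite mxE tensmxE !mxE eq_sym (negbTE i'i) mul0r mulr0.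
rewrite summxE (bigD1 j) //= [X in _ + X + _]big1 => [|j' j'j]; last first.
  rewrite !summxE big1 // => p' _; rewrite !summxE big1 // => q' _.
  by rewrite mxE tensmxE !mxE [j == _]eq_sym (negbTE j'j) andbF mul0r mulr0.
rewrite summxE (bigD1 p) //= [X in _ + X + _ + _]big1 => [|p' p'p]; last first.
  rewrite !summxE big1 // => q' _.
  by rewrite mxE tensmxE !mxE [p == _]eq_sym (negbTE p'p) /= !mulr0.
rewrite summxE (bigD1 q) //= [X in _ + X + _ + _ + _]big1 => [|q' q'q]; last first.
  by rewrite mxE tensmxE !mxE [q == _]eq_sym (negbTE q'q) andbF !mulr0.
by rewrite mxE tensmxE !mxE !eqxx !mulr1 !addr0.
Qed.

(** Expanding X in the matrix units E_ij (x) E_pq reduces this to the mixed product rule for [*t].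
    Being a conjugation, the extended map preserves positivity, so [Ad A] is completely positive. *)
Lemma tensmap_Ad k n (A : 'M[C]_n) (X : 'M[C]_(k * n)) :
  tensmap \1%VF (Ad A) X = (1%:M *t A) *m X *m (1%:M *t A) ^t*.
Proof.
rewrite lfunE /= /tensmap_fun [in RHS](tensmx_sum_delta X).
do 4!(rewrite mulmx_sumr mulmx_suml; apply: eq_bigr => ? _).
rewrite -scalemxAr -scalemxAl; congr (_ *: _).
rewrite trmx_tens map_mxT trmx1 map_mx1 !tensmx_mul mul1mx mulmx1.
by rewrite AdE id_lfunE.
Qed.

Lemma tensmap_sumr k n I (t : seq I) (Phi : 'End('M[C]_k))
    (F : I -> 'End('M[C]_n)) X :
  tensmap Phi (\sum_(i <- t) F i) X = \sum_(i <- t) tensmap Phi (F i) X.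
Proof.
under [RHS]eq_bigr => a _ do rewrite lfunE /= /tensmap_fun.
rewrite lfunE /= /tensmap_fun.
do 4!(rewrite [RHS]exchange_big /=; apply: eq_bigr => ? _).
rewrite -scaler_sumr; congr (_ *: _); rewrite sum_lfunE.
apply/matrixP => u v; rewrite !(mxE, summxE) mulr_sumr.
by apply: eq_bigr => a _; rewrite mxE.
Qed.

Lemma superpositive_cp r n : superpositive C r n `<=` completely_positive C n.
Proof.
move=> _ [m [A [_ ->]]] k X Xpsd; rewrite tensmap_sumr.
by apply: psdmx_sum => i; rewrite tensmap_Ad; apply: psdmx_conj.
Qed.

(* The Choi matrix of Phi is psd, hence of the form [B *m B ^t*]; the columns of
   B, reshaped into matrices, are Kraus operators of Phi. *)
Lemma completely_positiveE n : completely_positive C n = superpositive C n n.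
Proof.
apply/seteqP; split; last exact: superpositive_cp.
(* Complete positivity is used only for k = n, on w w^* with w the unnormalised maximally entangled
   vector: the image of w w^* is the Choi matrix. *)
move=> Phi /(_ n); pose w : 'M[C]_(n * n, 1 * 1) :=
  \sum_i (delta_mx i 0 : 'cV_n) *t (delta_mx i 0 : 'cV_n).
have wE : w *m w ^t* = \sum_i \sum_j delta_mx i j *t delta_mx i j.
  rewrite /w mulmx_suml; apply: eq_bigr => i _.
  rewrite linear_sum (map_mx_sum Num.conj) mulmx_sumr; apply: eq_bigr => j _.
  by rewrite /= trmx_tens map_mxT adjmx_delta tensmx_mul !mul_delta_mx.
move=> /(_ _ (psdmx_gram w)) /psdmx_factor[B]; rewrite wE => choiE.
have PhiE i j p q : Phi (delta_mx i j) p q =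
    \sum_l B (mxtens_index (i, p)) l * (B (mxtens_index (j, q)) l)^*.
  transitivity ((B *m B ^t*) (mxtens_index (i, p)) (mxtens_index (j, q)));
    last by rewrite mxE; apply: eq_bigr => l _; rewrite !mxE.
  rewrite -choiE linear_sum summxE (bigD1 i) //= [X in _ + X]big1.
    rewrite linear_sum summxE (bigD1 j) //= [X in _ + X + _]big1.
      by rewrite tensmapE tensmxE id_lfunE mxE !eqxx mul1r !addr0.
    move=> j' j'j; rewrite tensmapE tensmxE id_lfunE mxE.
    by rewrite [j == _]eq_sym (negbTE j'j) andbF mul0r.
  move=> i' i'i; rewrite linear_sum summxE big1 // => j' _.
  by rewrite /= tensmapE tensmxE id_lfunE mxE eq_sym (negbTE i'i) mul0r.
exists (n * n)%N, (fun l => \matrix_(p, i) B (mxtens_index (i, p)) l).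
split=> [l|]; first exact: rank_leq_row.
apply/lfunP => X; rewrite (matrix_sum_delta X) !linear_sum.
apply: eq_bigr => i _; rewrite !linear_sum; apply: eq_bigr => j _.
rewrite !linearZ /=; congr (_ *: _); apply/matrixP => p q.
rewrite PhiE sum_lfunE summxE; apply: eq_bigr => l _; rewrite AdE.
(* Writing E_ij as e_i e_j^T turns the conjugate of E_ij into the product of column i of the Kraus
   operator and the adjoint of its column j. *)
rewrite -(mul_delta_mx (0 : 'I_1)) mulmxA -colE -mulmxA -rowE.
by rewrite mxE big_ord1 !mxE.
Qed.

Lemma transpose_conj_Ad n (A : 'M[C]_n) :
  (transpose_map C n \o Ad A \o transpose_map C n)%VF = Ad (A ^t*)^T.
Proof.
apply/lfunP => X; rewrite !comp_lfunE !AdE !transpose_mapE !trmx_mul !trmxK.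
by rewrite map_mxCK mulmxA.
Qed.

Lemma completely_positive_transpose n (Phi : 'End('M[C]_n)) :
  completely_positive C n Phi ->
  completely_positive C n (transpose_map C n \o Phi \o transpose_map C n)%VF.
Proof.
rewrite completely_positiveE => -[m [A [_ ->]]].
rewrite comp_lfun_sumr comp_lfun_suml; apply: superpositive_sum => i.
by rewrite transpose_conj_Ad; apply/superpositive_Ad/rank_leq_row.
Qed.

End Superpositive.

(** * The reduction map and the cones it generates *)

Section Reduction.
Set Implicit Arguments.
Unset Strict Implicit.
Variable C : numClosedFieldType.

Lemma reduction_transposeE n (X : 'M[C]_n) :
  (reduction_map C n \o transpose_map C n)%VF X = \tr X *: 1%:M - X^T.
Proof. by rewrite comp_lfunE transpose_mapE reduction_mapE mxtrace_tr. Qed.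

Lemma antisym_delta_conj n (i j : 'I_n) (X : 'M[C]_n) :
  let J := delta_mx i j - delta_mx j i in
  J *m X *m J ^t* = X j j *: delta_mx i i - X j i *: delta_mx i j
    - (X i j *: delta_mx j i - X i i *: delta_mx j j).
Proof.
rewrite /= adjmxB !adjmx_delta !mulmxBl !mulmxBr.
by rewrite !mul_delta_mx_delta.
Qed.

Lemma reduction_transpose_superpositive n :
  superpositive C 2 n (reduction_map C n \o transpose_map C n)%VF.
Proof.
pose J (i j : 'I_n) : 'M[C]_n := delta_mx i j - delta_mx j i.
(* The sum runs over ordered pairs: [J i j] and [J j i] differ by a sign and give the same
   conjugation, whence the weight 1/2, put into the operator as its square root. *)
suff -> : (reduction_map C n \o transpose_map C n)%VF
    = \sum_i \sum_j Ad (sqrtC 2^-1 *: J i j).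
  apply: superpositive_sum => i; apply: superpositive_sum => j.
  apply: superpositive_Ad; apply: leq_trans (mxrank_scale _ _) _.
  apply: leq_trans (mxrank_add _ _) _.
  by rewrite mxrank_opp !mxrank_delta.
have half_ge0 : 0 <= 2^-1 :> C by rewrite invr_ge0 ler0n.
apply/lfunP => X; rewrite reduction_transposeE sum_lfunE.
have AdJE i j : Ad (sqrtC 2^-1 *: J i j) X = 2^-1 *: (J i j *m X *m (J i j) ^t*).
  rewrite AdE adjmxZ -!scalemxAl -scalemxAr scalerA.
  by rewrite -normCK ger0_norm ?sqrtC_ge0 // sqrtCK.
(* Of the four sums from [antisym_delta_conj], the two diagonal ones each give Tr(X) I and the two
   others each give X^T. *)
have sumE : \sum_i \sum_j J i j *m X *m (J i j) ^t* = 2 *: (\tr X *: 1%:M - X^T).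
  have diagE : \sum_i \sum_j X j j *: (delta_mx i i : 'M[C]_n) = \tr X *: 1%:M.
    under eq_bigr => i _ do rewrite -scaler_suml.
    by rewrite -scaler_sumr -mx1_sum_delta.
  have offE : \sum_i \sum_j X j i *: delta_mx i j = X^T.
    rewrite [RHS]matrix_sum_delta; apply: eq_bigr => i _; apply: eq_bigr => j _.
    by rewrite mxE.
  under eq_bigr => i _ do under eq_bigr => j _ do rewrite antisym_delta_conj.
  under eq_bigr => i _ do rewrite !sumrB.
  rewrite !sumrB diagE offE [X in _ - (X - _)]exchange_big /= offE.
  rewrite [X in _ - (_ - X)]exchange_big /= diagE opprB.
  by rewrite [2]/(1 + 1) scalerDl !scale1r.
under eq_bigr => i _ do (rewrite sum_lfunE; under eq_bigr => j _ do rewrite AdJE).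
under eq_bigr => i _ do rewrite -scaler_sumr.
by rewrite -scaler_sumr sumE scalerA mulVf ?scale1r // pnatr_eq0.
Qed.

(** For 2 x 2 matrices, Tr(Y) I - Y^T = J Y J^* with J = E_12 - E_21; the projection D restricts to
    this block. *)
Lemma reduction_transpose_compress n (i j : 'I_n) :
  i != j -> let D : 'M[C]_n := delta_mx i i + delta_mx j j in
  (Ad D \o ((reduction_map C n \o transpose_map C n) \o Ad D))%VF
    = Ad (delta_mx i j - delta_mx j i).
Proof.
move=> ij D; have DE : D ^t* = D by rewrite adjmxD !adjmx_delta.
have DD : D *m D = D.
  rewrite mulmxDl !mulmxDr !mul_delta_mx !mul_delta_mx_0 // 1?eq_sym //.
  by rewrite addr0 add0r.
have DT : D^T = D by rewrite linearD /= !trmx_delta.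
have DXD Y : D *m Y *m D = Y i i *: delta_mx i i + Y i j *: delta_mx i j
    + (Y j i *: delta_mx j i + Y j j *: delta_mx j j).
  by rewrite !mulmxDl !mulmxDr !mul_delta_mx_delta.
have trdelta k l : \tr (delta_mx k l : 'M[C]_n) = (k == l)%:R.
  rewrite /mxtrace (bigD1 k) //= big1 => [|u uk]; last by rewrite mxE (negbTE uk).
  by rewrite mxE eqxx addr0.
apply/lfunP => X; rewrite [LHS]comp_lfunE comp_lfunE reduction_transposeE !AdE DE.
rewrite antisym_delta_conj !trmx_mul DT mulmxBr mulmxBl -scalemxAr -scalemxAl.
rewrite mulmx1 DD !mulmxA DD -[_ *m D *m D]mulmxA DD !DXD !mxtraceD !mxtraceZ !trdelta.
rewrite !eqxx [j == i]eq_sym (negbTE ij) !mulr0 !mulr1 addr0 add0r.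
by apply/matrixP => s t; rewrite !mxE; ring.
Qed.

Lemma pid_mx2 n : pid_mx 2 =
  delta_mx ord0 ord0 + delta_mx (lift ord0 ord0) (lift ord0 ord0)
  :> 'M[C]_n.+2.
Proof.
apply/matrixP => i j; rewrite !mxE -!val_eqE /=.
case: i j => [[|[|i]] ?] [[|[|j]] ?] //=; rewrite ?addr0 ?add0r //.
by rewrite andbF.
Qed.

Lemma Ad_factor_reduction (n : nat) (A : 'M[C]_n) :
  n != 1%N -> (\rank A <= 2)%N ->
  exists P Q : 'M[C]_n,
    Ad A = (Ad P \o ((reduction_map C n \o transpose_map C n) \o Ad Q))%VF.
Proof.
(* For n = 0 all maps coincide. For n = 1 the map R \o t is zero, so no nonzero [Ad A] could factor
   through it. *)
case: n A => [|[|n]] // A _ rA.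
  by exists 0, 0; apply/lfunP => X; apply/matrixP => -[].
pose i : 'I_n.+2 := ord0; pose j : 'I_n.+2 := lift ord0 ord0.
pose J : 'M[C]_n.+2 := delta_mx i j - delta_mx j i.
pose D : 'M[C]_n.+2 := delta_mx i i + delta_mx j j.
have JJ : J *m J = - D.
  rewrite mulmxBl !mulmxBr !mul_delta_mx !mul_delta_mx_0 //.
  by rewrite sub0r subr0 opprD.
(* The factors D compress R \o t to [Ad J]. The sign and the extra J cancel against J J = - D, and D
   = [pid_mx 2] is absorbed by [pid_mx (\rank A)] since the rank is at most 2; what remains is the
   rank factorization of A. *)
exists (- col_ebase A *m pid_mx (\rank A) *m J *m D), (D *m row_ebase A).
rewrite -[Ad (_ *m D)]Ad_comp -[Ad (D *m _)]Ad_comp.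
have := reduction_transpose_compress (isT : i != j); rewrite /= -/D -/J => RJ.
rewrite [X in (_ \o X)%VF]comp_lfunA -comp_lfunA.
rewrite [X in (_ \o X)%VF]comp_lfunA RJ !Ad_comp !mulmxA.
have D2 : D = pid_mx 2 by rewrite pid_mx2.
rewrite -[_ *m J *m J]mulmxA JJ -[_ *m - D]mulmxA mulmxN D2.
rewrite mul_pid_mx (minn_idPl rA) (minn_idPr _) ?rank_leq_row //.
by rewrite mulNmx mulmxN opprK mulmx_ebase.
Qed.

Lemma mapping_cone_reduction_transpose (n : nat) : n != 1%N ->
  mapping_cone [set (reduction_map C n \o transpose_map C n)%VF]
    = superpositive C 2 n.
Proof.
move=> n1; apply/seteqP; split=> Theta.
  move=> [m [Phi [Omega [Psi [cone ->]]]]]; apply: superpositive_sum => i.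
  have [-> + +] := cone i.
  rewrite completely_positiveE => Phi_sp Psi_sp.
  have RPsi := superpositive_comp (reduction_transpose_superpositive n) Psi_sp.
  (* The completely positive factors are n-superpositive, so the rank bound obtained is min(n,
     min(2, n)). *)
  apply: superpositive_le (superpositive_comp Phi_sp RPsi).
  by rewrite (leq_trans (geq_minr _ _)) ?geq_minl.
move=> [m [A [rA ->]]].
have /fin_all_exists[P /fin_all_exists[Q AE]] :=
  fun i => Ad_factor_reduction n1 (rA i).
exists m, (fun i => Ad (P i)),
  (fun=> (reduction_map C n \o transpose_map C n)%VF), (fun i => Ad (Q i)).
split=> [i|]; last by apply: eq_bigr => i _; apply: AE.
by split=> //; apply/superpositive_cp/superpositive_Ad/rank_leq_row.
Qed.

(** As t is an involution, Phi \o Omega \o Psi = (Phi \o (Omega \o t) \o (t \o Psi \o t)) \o t; the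
    same replacement of Psi serves in both directions. *)
Lemma mapping_cone_comp_transpose n (Omega : 'End('M[C]_n)) :
  mapping_cone [set Omega] =
  [set (Theta \o transpose_map C n)%VF
    | Theta in mapping_cone [set (Omega \o transpose_map C n)%VF]].
Proof.
set t := transpose_map C n; apply/seteqP; split=> Theta.
  move=> [m [Phi [Omega' [Psi [cone ->]]]]].
  exists (\sum_i (Phi i \o ((Omega \o t) \o (t \o Psi i \o t)))%VF).
    exists m, Phi, (fun=> (Omega \o t)%VF), (fun i => (t \o Psi i \o t)%VF).
    split=> // i; have [_ Phi_cp Psi_cp] := cone i.
    by split=> //; apply: completely_positive_transpose.
  rewrite comp_lfun_suml; apply: eq_bigr => i _; have [-> _ _] := cone i.
  by apply/lfunP => X; rewrite !comp_lfunE !transpose_mapE !trmxK.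
move=> [_ [m [Phi [Omega' [Psi [cone ->]]]]] <-].
exists m, Phi, (fun=> Omega), (fun i => (t \o Psi i \o t)%VF).
split=> [i|].
  have [_ Phi_cp Psi_cp] := cone i.
  by split=> //; apply: completely_positive_transpose.
rewrite comp_lfun_suml; apply: eq_bigr => i _; have [-> _ _] := cone i.
by apply/lfunP => X; rewrite !comp_lfunE.
Qed.

End Reduction.

Theorem proposition4 (R : realType) (n : nat) (n_neq1 : n != 1%N) :
  mapping_cone [set reduction_map R[i] n]
    = [set (Phi \o transpose_map R[i] n)%VF | Phi in superpositive R[i] 2 n]
  /\ mapping_cone [set (reduction_map R[i] n \o transpose_map R[i] n)%VF]
    = superpositive R[i] 2 n.
Proof.
have cone_Rt := mapping_cone_reduction_transpose R[i] n_neq1.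
by split=> //; rewrite mapping_cone_comp_transpose cone_Rt.
Qed.
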